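(* Let $H$ be a real Hilbert space, let $\Lambda\subset H$ be an oriented real two-dimensional linear subspace with oriented orthonormal basis $e_1,e_2$, let $p_\perp\in\Lambda^\perp$ and $b=|p_\perp|$, and let $c>0$ and $0\le s<1$. Let $\Phi=(\xi,\eta)\in L^1(\mathbb T,H)$ with $\xi\in L^1(\mathbb T,\Lambda)$, $\eta\in L^1(\mathbb T,\Lambda^\perp)$, and let $\phi=\xi_1+i\xi_2$ be the complex coordinate of $\xi=\xi_1e_1+\xi_2e_2$. Assume that $$\widehat\phi(0)=a\in\mathbb R,\qquad \widehat\phi(1)=A\in\mathbb C,\qquad \widehat\phi(-1)=B\in\mathbb C,$$ and $$\int_{\mathbb T}\eta\,dm=p_\perp,\qquad \int_{\mathbb T}\eta(e^{it})\cos t\,dm=0.$$ Then $$I_s^c(\Phi)=c\,\operatorname{Re}\bigl(A+2sa+s^2B\bigr)+(1+s^2)b^2.$$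
   Context: $\mathbb D=\{z\in\mathbb C:|z|<1\}$, $\mathbb T=\partial\mathbb D$, and $m$ is normalized Lebesgue measure on $\mathbb T$ (total mass $1$). Fourier coefficients are $\widehat\phi(n)=\int_{\mathbb T}\phi(e^{it})e^{-int}\,dm$. Integrals of Hilbert-valued functions are Bochner integrals; $\langle\cdot,\cdot\rangle$ is the real inner product of $H$. For $0\le s<1$ set $$\mathcal M_s(\zeta)=\frac{s+\zeta}{1+s\zeta}\quad(\zeta\in\overline{\mathbb D}),\qquad w_s(z)=|1+sz|^2\quad(z\in\mathbb T),$$ $$E_s^c(\zeta)=p_\perp+c\operatorname{Re}\mathcal M_s(\zeta)\,e_1+c\operatorname{Im}\mathcal M_s(\zeta)\,e_2\quad(\zeta\in\overline{\mathbb D}).$$ The Möbius-weighted Hilbert pairing of $\Phi\in L^1(\mathbb T,H)$ is $$I_s^c(\Phi)=\int_{\mathbb T}w_s(z)\langle\Phi(z),E_s^c(z)\rangle\,dm(z).$$ *)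

(* Defs.v *)
From HB Require Import structures.
From mathcomp Require Import all_boot all_order all_algebra.
From mathcomp Require Import complex.
From mathcomp Require Import all_classical all_reals all_analysis.
From mathcomp Require Import measurable_realfun.

Set Implicit Arguments.
Unset Strict Implicit.
Unset Printing Implicit Defensive.

Import Order.TTheory GRing.Theory Num.Theory.
Import numFieldNormedType.Exports.

Local Open Scope classical_set_scope.
Local Open Scope complex_scope.
Local Open Scope ring_scope.

(* Completeness, the topology and the norm come from the underlying
   completeNormedModType; the last axiom makes that norm the Hilbert norm. *)
HB.mixin Record CompleteNormedModule_isHilbert (R : realType) (H : Type)
    of CompleteNormedModule R H := {
  inner : H -> H -> R ;
  innerC : forall x y, inner x y = inner y x ;
  innerDl : forall x y z, inner (x + y) z = inner x z + inner y z ;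
  innerZl : forall (a : R) x y, inner (a *: x) y = a * inner x y ;
  inner_normE : forall x, inner x x = `|x| ^+ 2 }.

#[short(type="hilbertType")]
HB.structure Definition Hilbert (R : realType) :=
  {H of CompleteNormedModule_isHilbert R H & CompleteNormedModule R H}.

Section plane.
Context {R : realType} {H : hilbertType R}.

(* An orientation is a class of ordered bases, two bases being equivalent when
   the change of basis has positive determinant. *)
Record oriented_plane := OrientedPlane {
  plane_set :> set H ;
  positive_basis : H -> H -> Prop ;
  oriented_planeP : exists u v : H,
    [/\ forall a b : R, a *: u + b *: v = 0 -> a = 0 /\ b = 0,
        plane_set = [set x | exists a b : R, x = a *: u + b *: v] &
        forall u' v', positive_basis u' v' <->
          exists a b c d : R, [/\ u' = a *: u + b *: v,
            v' = c *: u + d *: v & 0 < a * d - b * c]] }.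

Definition oriented_orthonormal_basis (L : oriented_plane) (e1 e2 : H) :=
  [/\ positive_basis L e1 e2, inner e1 e1 = 1, inner e2 e2 = 1 &
      inner e1 e2 = 0].

Definition ortho_compl (V : set H) : set H :=
  [set x | forall y, V y -> inner x y = 0].

Definition complex_coord (e1 e2 x : H) : R[i] := inner x e1 +i* inner x e2.

Lemma complex_coordE (L : oriented_plane) (e1 e2 : H) (a b : R) :
  oriented_orthonormal_basis L e1 e2 ->
  complex_coord e1 e2 (a *: e1 + b *: e2) = a +i* b.
Proof.
move=> [_ e11 e22 e12]; rewrite /complex_coord !innerDl !innerZl.
by rewrite (innerC e2 e1) e11 e22 e12 !mulr1 !mulr0 addr0 add0r.
Qed.

End plane.
Arguments oriented_plane {R} H.

Section bochner.
Local Open Scope ereal_scope.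
Context {d : measure_display} {T : measurableType d} {R : realType}.
Context {E : completeNormedModType R}.
Variable mu : {measure set T -> \bar R}.

Definition bochner_simple (f : T -> E) :=
  [/\ finite_set (range f),
      forall x, measurable (f @^-1` [set x]) &
      forall x, x != 0%R -> mu (f @^-1` [set x]) < +oo].

(* When mu (f @^-1` [set 0]) = +oo, [fine] sends it to 0; the corresponding
   term vanishes anyway. *)
Definition simple_integral (f : T -> E) : E :=
  (\sum_(x \in range f) fine (mu (f @^-1` [set x])) *: x)%R.

(* Pointwise convergence everywhere makes f, hence every `|f - s_ n|,
   measurable; without it the lower integral \int of a nonmeasurable function
   would be meaningless. Every class modulo mu-a.e. equality of Bochner
   integrable functions has such a representative. *)
Definition bochner_approx (f : T -> E) (s_ : nat -> T -> E) :=
  [/\ forall n, bochner_simple (s_ n),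
      forall t, s_ n t @[n --> \oo] --> f t &
      \int[mu]_t (`|f t - s_ n t|%R)%:E @[n --> \oo] --> 0].

Definition bochner_integrable (f : T -> E) := exists s_, bochner_approx f s_.

(* Junk value 0 when f is not integrable. *)
Definition bochner_integral (f : T -> E) : E :=
  xget 0%R [set v | exists2 s_, bochner_approx f s_ &
                    simple_integral (s_ n) @[n --> \oo] --> v].

(* V is meant to be a closed linear subspace of E. *)
Definition L1 (V : set E) (f : T -> E) :=
  bochner_integrable f /\ {ae mu, forall t, V (f t)}.

Definition complex_integral (f : T -> R[i]) : R[i] :=
  (\int[mu]_t complex.Re (f t))%R +i* (\int[mu]_t complex.Im (f t))%R.

End bochner.

Section circle.
Context {R : realType}.

Definition circle : Type := {z : R[i] | `|z| == 1}.

HB.instance Definition _ := Choice.on circle.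

Lemma expi_subproof (t : R) : `|cos t +i* sin t| == 1 :> R[i].
Proof. by rewrite normc_def /= cos2Dsin2 sqrtr1. Qed.

Definition expi (t : R) : circle := exist _ (cos t +i* sin t) (expi_subproof t).

HB.instance Definition _ := isPointed.Build circle (expi 0).

Definition circle_coords (z : circle) : measurableTypeR R * measurableTypeR R :=
  (complex.Re (val z), complex.Im (val z)).

(* The Borel sets of the circle are the traces of the Borel sets of the plane. *)
HB.instance Definition _ :=
  Measurable.copy circle (g_sigma_algebra_preimageType circle_coords).

Lemma measurable_expi :
  measurable_fun [set: measurableTypeR R] (expi : measurableTypeR R -> circle).
Proof.
move=> _ _ [B mB <-]; rewrite setTI setTI -comp_preimage.
rewrite -[X in measurable X]setTI.
suff : measurable_fun [set: measurableTypeR R] (circle_coords \o expi).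
  by apply.
apply/measurable_fun_pairP; split.
- exact: (continuous_measurable_fun (@continuous_cos R)).
- exact: (continuous_measurable_fun (@continuous_sin R)).
Qed.

HB.instance Definition _ :=
  isMeasurableFun.Build _ _ _ _ (expi : measurableTypeR R -> circle)
    measurable_expi.

Lemma twopi_gt0 : 0 < 2 * pi :> R.
Proof. by rewrite mulr_gt0 ?pi_gt0. Qed.

Definition arc_measure : probability circle R :=
  distribution (uniform_prob twopi_gt0)
    (expi : {mfun measurableTypeR R >-> circle}).

End circle.
Arguments circle R : clear implicits.

Section moebius.
Context {R : realType}.

Definition fourier_coef (phi : circle R -> R[i]) (n : int) : R[i] :=
  complex_integral arc_measure (fun z => phi z * val z ^ (- n)).

Definition moebius (s : R) (z : R[i]) : R[i] := (s%:C + z) / (1 + s%:C * z).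

Definition moebius_weight (s : R) (z : R[i]) : R :=
  ComplexField.Normc.normc (1 + s%:C * z) ^+ 2.

Context {H : hilbertType R}.

Definition moebius_curve (e1 e2 p : H) (c s : R) (z : R[i]) : H :=
  p + (c * complex.Re (moebius s z)) *: e1 + (c * complex.Im (moebius s z)) *: e2.

Definition moebius_pairing (e1 e2 p : H) (c s : R) (Phi : circle R -> H) : R :=
  \int[arc_measure]_z (moebius_weight s (val z) *
    inner (Phi z) (moebius_curve e1 e2 p c s (val z))).

End moebius.

(* Main.v *)
Require Import Defs.
From mathcomp Require Import all_boot all_order all_algebra finmap.
From mathcomp Require Import complex ring lra zify.
From mathcomp Require Import all_classical all_reals all_analysis.
From mathcomp Require Import measurable_realfun.

Import Order.TTheory GRing.Theory Num.Theory.
Import numFieldNormedType.Exports.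

Local Open Scope classical_set_scope.
Local Open Scope complex_scope.
Local Open Scope ring_scope.

(** The weight clears the denominator of the Moebius map: on the unit circle,
    with z = x + iy, the product of |1+sz|^2 and (s+z)/(1+sz) is
      (s+z) * conj (1+sz) = z + 2s + s^2 conj z,
    while the weight itself is 1 + s^2 + 2sx. The integrand of the pairing is
    therefore a trigonometric polynomial of degree one in each scalar component
    of Phi ([weighted_moebius_curveE]). The components along e1 and e2 only see
    xi and produce the real parts of the Fourier coefficients of order -1, 0 and
    1; the component along p only sees eta, and the two moments prescribed for
    eta give (1 + s^2) |p|^2 + 2s * 0.

    The analytic content is the passage from Bochner integrals to integrals of
    real functions, <int f, w> = int <f, w> ([inner_bochner_integral]). The
    Bochner integral takes a junk value when no limit exists, so the limit of the
    simple integrals has to be produced, for eta and also for Re z * eta. The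
    first is a Cauchy argument by duality ([simple_integral_cvg]): testing a
    difference of simple integrals against itself bounds its norm by the two
    approximation errors. The second is the stability of Bochner integrability
    under measurable multipliers bounded by 1 ([bochner_integrableZ]). *)

(** * Inner products *)

Section inner_product.
Context {R : realType} {H : hilbertType R}.
Implicit Types x y z : H.

Lemma innerDr x y z : inner x (y + z) = inner x y + inner x z.
Proof. by rewrite innerC innerDl !(innerC x). Qed.

Lemma innerZr (a : R) x y : inner x (a *: y) = a * inner x y.
Proof. by rewrite innerC innerZl (innerC x). Qed.

Lemma inner0l y : inner (0 : H) y = 0.
Proof. by rewrite -(scale0r (0 : H)) innerZl mul0r. Qed.

Lemma innerBl x y z : inner (x - y) z = inner x z - inner y z.
Proof. by rewrite innerDl -scaleN1r innerZl mulN1r. Qed.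

Lemma innerBr x y z : inner x (y - z) = inner x y - inner x z.
Proof. by rewrite innerC innerBl !(innerC x). Qed.

Lemma cauchy_schwarz x y : `|inner x y| <= `|x| * `|y|.
Proof.
have [->|y0] := eqVneq y 0; first by rewrite innerC inner0l !normr0 mulr0.
have yn0 : 0 < `|y| ^+ 2 by rewrite exprn_gt0// normr_gt0.
(* the squared distance from x to its projection on the line of y *)
have : 0 <= `|x - (inner x y / `|y| ^+ 2) *: y| ^+ 2 by exact: sqr_ge0.
rewrite -inner_normE innerBl !innerBr !innerZr !innerZl (innerC y x) !inner_normE.
have -> : `|x| ^+ 2 - inner x y / `|y| ^+ 2 * inner x y
    - (inner x y / `|y| ^+ 2 * inner x y
       - inner x y / `|y| ^+ 2 * (inner x y / `|y| ^+ 2 * `|y| ^+ 2))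
    = `|x| ^+ 2 - inner x y ^+ 2 / `|y| ^+ 2.
  by field; rewrite normr_eq0.
rewrite subr_ge0 ler_pdivrMr// => h.
by rewrite -(@ler_sqr _ `|_|) ?nnegrE ?mulr_ge0// exprMn real_normK ?num_real.
Qed.

Lemma inner_suml (I : Type) (r : seq I) (F : I -> H) w :
  inner (\sum_(i <- r) F i) w = \sum_(i <- r) inner (F i) w.
Proof.
elim/big_rec2: _ => [|i x y _ <-]; first exact: inner0l.
exact: innerDl.
Qed.

Lemma continuous_inner w : continuous (fun x : H => inner x w).
Proof.
move=> x; apply/cvgrPdist_le => /= e e0.
have w0 : 0 < `|w| + 1 by rewrite ltr_pwDr.
near=> y.
rewrite -innerBl (le_trans (cauchy_schwarz _ _))//.
apply: (@le_trans _ _ (e / (`|w| + 1) * (`|w| + 1))); last by rewrite divfK// gt_eqF.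
apply: ler_pM => //; last by rewrite lerDl.
near: y; apply: cvgr_dist_le => //; by rewrite divr_gt0.
Unshelve. all: by end_near. Qed.

End inner_product.

(** * Finitely valued measurable maps *)

Section finitely_valued.
Context {d : measure_display} {T : measurableType d}.

(** The measure-free part of [bochner_simple], for values in any type: pairs of
    such maps are again of this kind, which gives the measurability of functions
    of several of them. *)
Definition finitely_valued {X : choiceType} (f : T -> X) :=
  finite_set (range f) /\ forall x, measurable (f @^-1` [set x]).

Lemma finitely_valued_preimage {X : choiceType} {f : T -> X} (B : set X) :
  finitely_valued f -> measurable (f @^-1` B).
Proof.
move=> [fin mf].
have -> : f @^-1` B = \bigcup_(x in range f `&` B) f @^-1` [set x].
  apply/seteqP; split=> [t Bt|t [x [_ Bx]] /= ->//].
  by exists (f t) => //; split => //; exists t.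
apply: fin_bigcup_measurable => //.
by apply: sub_finite_set fin => x [].
Qed.

Lemma finitely_valued_comp {X Y : choiceType} {f : T -> X} (h : X -> Y) :
  finitely_valued f -> finitely_valued (h \o f).
Proof.
move=> sf; split=> [|y]; last first.
  by rewrite comp_preimage; exact: finitely_valued_preimage.
by case: sf => fin _; rewrite -(image_comp f h); exact: finite_image.
Qed.

Lemma finitely_valued_pair {X Y : choiceType} {f : T -> X} {g : T -> Y} :
  finitely_valued f -> finitely_valued g -> finitely_valued (fun t => (f t, g t)).
Proof.
move=> [ff mf] [fg mg]; split=> [|[x y]].
  apply: (sub_finite_set _ (finite_setX ff fg)) => _ [t _ <-].
  by split; exists t.
have -> : (fun t => (f t, g t)) @^-1` [set (x, y)] =
          f @^-1` [set x] `&` g @^-1` [set y].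
  by apply/seteqP; split=> [t [<- <-]|t [/= <- <-]].
exact: measurableI.
Qed.

Lemma finitely_valued_measurable {R : realType} (f : T -> R) :
  finitely_valued f -> measurable_fun [set: T] f.
Proof. by move=> sf _ B mB; rewrite setTI; exact: finitely_valued_preimage. Qed.

End finitely_valued.

(** * Bochner integrals in a Hilbert space *)

Section bochner.
Context {d : measure_display} {T : measurableType d} {R : realType}.
Context {H : hilbertType R}.
Variable mu : {finite_measure set T -> \bar R}.
Implicit Types (f s : T -> H) (g : T -> R) (n : nat).

Lemma bochner_simpleP s : bochner_simple mu s <-> finitely_valued s.
Proof.
split=> [[fs ms _]|[fs ms]]; first by split.
by split=> // x _; rewrite ltey_eq fin_num_measure.
Qed.

(** The integrand is a finite sum of integrable functions: h x times the
    indicator of the fibre of s over x, for x in the range of s. *)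
Lemma integral_finitely_valued {X : choiceType} {s : T -> X} (h : X -> R) :
  finitely_valued s ->
  mu.-integrable [set: T] (fun t => (h (s t))%:E) /\
  \int[mu]_t h (s t) =
    \sum_(x <- fset_set (range s)) h x * fine (mu (s @^-1` [set x])).
Proof.
move=> [fs ms].
pose F x t := h x * \1_(s @^-1` [set x]) t.
have iF x : mu.-integrable [set: T] (fun t => (F x t)%:E).
  under eq_fun do rewrite EFinM.
  by apply: integrableZl => //; exact: integrable_indic.
have sE t : (h (s t))%:E = (\sum_(x <- fset_set (range s)) (F x t)%:E)%E.
  rewrite sumEFin; congr EFin.
  rewrite (bigD1_seq (s t)) ?fset_uniq//=; last first.
    by rewrite in_fset_set// inE; exists t.
  rewrite big1 ?addr0 /F ?indicE ?mem_set ?mulr1// => x xs.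
  by rewrite indicE memNset ?mulr0// => /= /esym/eqP; rewrite (negbTE xs).
split.
  under eq_fun do rewrite sE; exact: integrable_sum.
rewrite /Rintegral; under eq_integral do rewrite sE.
rewrite integral_sum// -sum_fine; last first.
  by move=> x _; exact: integrable_fin_num.
apply: eq_bigr => x _.
rewrite -/(Rintegral _ _ _) RintegralZl//; last exact: integrable_indic.
by rewrite /Rintegral integral_indic// setIT.
Qed.

Lemma inner_simple_integral s w : finitely_valued s ->
  inner (simple_integral mu s) w = \int[mu]_t inner (s t) w.
Proof.
move=> sfin; have [_ ->] := integral_finitely_valued (fun x => inner x w) sfin.
rewrite /simple_integral fsbig_finite/=; last by case: sfin.
by rewrite inner_suml; apply: eq_bigr => x _; rewrite innerZl mulrC.
Qed.

(** The difference f - v is approached directly, by the finitely valued u_m - v: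
    without separability of H, sums of two Borel measurable H-valued functions
    need not be Borel measurable. *)
Lemma measurable_norm_sub {f v : T -> H} {u : nat -> T -> H} :
  (forall n, finitely_valued (u n)) -> (forall t, u n t @[n --> \oo] --> f t) ->
  finitely_valued v -> measurable_fun [set: T] (fun t => `|f t - v t|).
Proof.
move=> ufin uf vfin.
apply: (@measurable_fun_cvg _ _ _ _ (fun m t => `|u m t - v t|)) => [m|t _].
  apply: finitely_valued_measurable.
  exact: (finitely_valued_comp (fun p : H * H => `|p.1 - p.2|)
    (finitely_valued_pair (ufin m) vfin)).
by apply: cvg_norm; apply: cvgB; [exact: uf|exact: cvg_cst].
Qed.

Section approximation.
Context {f : T -> H} {s_ : nat -> T -> H}.
Hypothesis fs : bochner_approx mu f s_.

Let sfin n : finitely_valued (s_ n).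
Proof. by case: fs => sn _ _; apply/bochner_simpleP. Qed.

Lemma measurable_continuous_bochner {h : H -> R} : continuous h ->
  measurable_fun [set: T] (h \o f).
Proof.
move=> ch; apply: (@measurable_fun_cvg _ _ _ _ (fun n => h \o s_ n)) => [m|t _].
  by apply: finitely_valued_measurable; exact: finitely_valued_comp.
case: fs => _ /(_ t) ft _; apply: continuous_cvg; [exact: ch|exact: ft].
Qed.

Lemma measurable_bochner_error n : measurable_fun [set: T] (fun t => `|f t - s_ n t|).
Proof.
by case: fs => _ sf _; exact: (measurable_norm_sub sfin sf (sfin n)).
Qed.

Let err n := \int[mu]_t `|f t - s_ n t|.

Lemma near_integrable_bochner_error : \forall n \near \oo,
  mu.-integrable [set: T] (fun t => `|f t - s_ n t|%:E).
Proof.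
case: fs => _ _ /fine_cvgP[+ _]; apply: filterS => n en.
apply/integrableP; split; first by apply/measurable_EFinP; exact: measurable_bochner_error.
under eq_integral do rewrite /= normr_id.
by rewrite ltey_eq en.
Qed.

Lemma bochner_error_cvg0 : err n @[n --> \oo] --> 0.
Proof. by case: fs => _ _ /fine_cvgP[_]. Qed.

Lemma integrable_norm_bochner : mu.-integrable [set: T] (fun t => `|f t|%:E).
Proof.
have [n ien] : exists n, mu.-integrable [set: T] (fun t => `|f t - s_ n t|%:E).
  by have [N _ hN] := near_integrable_bochner_error; exists N; apply: hN => /=.
have [isn _] := integral_finitely_valued (fun x => `|x|) (sfin n).
have := @integrableD _ _ _ mu _ measurableT _ _ ien isn.
apply: le_integrable => //.
  apply/measurable_EFinP.
  exact: (measurable_continuous_bochner (@norm_continuous _ _)).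
move=> t _ /=; rewrite lee_fin [leRHS]ger0_norm ?addr_ge0//.
by rewrite normr_id (le_trans _ (ler_normD _ _))// subrK.
Qed.

Lemma integrable_inner_bochner w :
  mu.-integrable [set: T] (fun t => (inner (f t) w)%:E).
Proof.
have := @integrableZr _ _ _ mu _ measurableT `|w| _ integrable_norm_bochner.
apply: le_integrable => //.
  apply/measurable_EFinP.
  exact: (measurable_continuous_bochner (continuous_inner w)).
move=> t _ /=; rewrite lee_fin normrM !normr_id; exact: cauchy_schwarz.
Qed.

(** Since the bound depends on w through its norm alone, the weak convergence of
    the simple integrals is uniform over bounded sets of w. *)
Lemma simple_integral_error w {n} :
  mu.-integrable [set: T] (fun t => `|f t - s_ n t|%:E) ->
  `|inner (simple_integral mu (s_ n)) w - \int[mu]_t inner (f t) w|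
     <= `|w| * err n.
Proof.
move=> ien; rewrite inner_simple_integral// distrC.
have [isn _] := integral_finitely_valued (fun x => inner x w) (sfin n).
have ifn := integrable_inner_bochner w.
rewrite -RintegralB//; apply: le_trans.
  apply: le_normr_Rintegral => //; exact: (integrableB measurableT ifn isn).
rewrite -RintegralZl//; apply: le_Rintegral => //.
- exact: (integrable_abse (integrableB measurableT ifn isn)).
- exact: (integrableZl measurableT `|w| ien).
- by move=> t _; rewrite -innerBl mulrC; exact: cauchy_schwarz.
Qed.

(** Weak convergence uniform over bounded sets is norm convergence: testing the
    difference of two simple integrals against itself bounds its norm by the sum
    of the two errors. *)
Lemma simple_integral_cvg : cvg (simple_integral mu (s_ n) @[n --> \oo]).
Proof.
apply/cauchy_cvgP/cauchyP => e e0.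
have e20 : 0 < e / 2 by rewrite divr_gt0.
have small : \forall n \near \oo, err n < e / 2.
  by apply: cvgr_lt e20; exact: bochner_error_cvg0.
have [N _ hN] : \forall n \near \oo,
    mu.-integrable [set: T] (fun t => `|f t - s_ n t|%:E) /\ err n < e / 2.
  by near=> n; split; near: n => //; exact: near_integrable_bochner_error.
exists (simple_integral mu (s_ N)); exists N => // n /hN[ien en].
have [ieN eN] := hN N (leqnn N).
set u := simple_integral mu (s_ N); set v := simple_integral mu (s_ n).
rewrite /= -ball_normE /=.
have [->|uv] := eqVneq (u - v) 0; first by rewrite normr0.
have uv0 : 0 < `|u - v| by rewrite normr_gt0.
rewrite -(ltr_pM2l uv0) -expr2 -inner_normE innerBl.
have aN := simple_integral_error (u - v) ieN.
have an := simple_integral_error (u - v) ien.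
rewrite -/u -/v in aN an.
have kN : `|u - v| * err N < `|u - v| * (e / 2) by rewrite ltr_pM2l.
have kn : `|u - v| * err n < `|u - v| * (e / 2) by rewrite ltr_pM2l.
move: aN an kN kn; rewrite !ler_norml => /andP[_ +] /andP[+ _].
rewrite [_ * (e / 2)]mulrA; lra.
Unshelve. all: by end_near. Qed.

Lemma inner_lim_simple_integral w v :
  simple_integral mu (s_ n) @[n --> \oo] --> v ->
  inner v w = \int[mu]_t inner (f t) w.
Proof.
move=> sv.
have : inner (simple_integral mu (s_ n)) w @[n --> \oo] --> inner v w.
  exact: (continuous_cvg _ (continuous_inner w v) sv).
move=> /(cvg_unique (@norm_hausdorff _ R^o)); apply.
apply/subr_cvg0/norm_cvg0P.
apply: (@squeeze_cvgr _ _ _ _ (cst 0) (fun n => `|w| * err n)).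
- near=> n; rewrite /= normr_ge0 /=; apply: simple_integral_error.
  by near: n; exact: near_integrable_bochner_error.
- exact: cvg_cst.
- rewrite -[X in _ --> X](mulr0 `|w|); apply: cvgM; first exact: cvg_cst.
  exact: bochner_error_cvg0.
Unshelve. all: by end_near. Qed.

End approximation.

(** Every approximation of f leads to a limit having these inner products, so the
    choice made by [bochner_integral] does not matter once some limit exists. *)
Lemma inner_bochner_integral f w : bochner_integrable mu f ->
  inner (bochner_integral mu f) w = \int[mu]_t inner (f t) w.
Proof.
move=> [s_ fs].
have [] : [set v | exists2 s_, bochner_approx mu f s_ &
    simple_integral mu (s_ n) @[n --> \oo] --> v] (bochner_integral mu f).
  apply: xgetPex; have /cvg_ex[v sv] := simple_integral_cvg fs.
  by exists v, s_.
by move=> s'_ fs' /(inner_lim_simple_integral fs' w).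
Qed.

(** Rounding g down to the multiples of 1/(n+1) gives finitely valued functions
    converging to g uniformly, and a uniform error is what the product with an
    unbounded f can absorb. *)
Definition grid_floor (n : nat) (g : T -> R) (t : T) : R :=
  (Num.floor (n.+1%:R * g t))%:~R / n.+1%:R.

Lemma grid_floor_dist n g t : `|g t - grid_floor n g t| <= n.+1%:R^-1.
Proof.
have n0 : (0 : R) < n.+1%:R by [].
have -> : g t - grid_floor n g t =
    (n.+1%:R * g t - (Num.floor (n.+1%:R * g t))%:~R) / n.+1%:R.
  by rewrite mulrBl mulrAC mulfV ?mul1r// gt_eqF.
have /andP[lo hi] := mem_rg1_floor (n.+1%:R * g t).
rewrite normrM [X in _ * X]gtr0_norm ?invr_gt0// ler_pdivrMr// mulVf ?gt_eqF//.
rewrite ger0_norm ?subr_ge0//.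
by rewrite lerBlDl ltW// intrD1.
Qed.

Lemma finitely_valued_grid_floor n g : measurable_fun [set: T] g ->
  (forall t, `|g t| <= 1) -> finitely_valued (grid_floor n g).
Proof.
move=> mg g1.
apply: (@finitely_valued_comp _ _ _ _ (fun t => Num.floor (n.+1%:R * g t))
  (fun k : int => k%:~R / n.+1%:R)).
split=> [|k].
  apply: (@sub_finite_set _ _ ((fun k : nat => k%:Z - n.+1%:Z) @` `I_(n.+1 + n.+2))).
    move=> _ [t _ <-].
    have n0 : (0 : R) < n.+1%:R by [].
    have /ler_normlP[gN1 g1t] := g1 t.
    have lo : - n.+1%:Z <= Num.floor (n.+1%:R * g t).
      by rewrite floor_ge_int mulrNz -mulrN1 ler_pM2l// lerNl.
    have hi : Num.floor (n.+1%:R * g t) <= n.+1%:Z.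
      have /andP[fle _] := floor_itv (n.+1%:R * g t).
      by rewrite -(ler_int R) (le_trans fle)// -[leRHS]mulr1 ler_pM2l.
    exists (absz (Num.floor (n.+1%:R * g t) + n.+1%:Z)) => /=; lia.
  exact/finite_image/finite_II.
have -> : (fun t => Num.floor (n.+1%:R * g t)) @^-1` [set k] =
    (fun t => n.+1%:R * g t) @^-1` `[k%:~R, (k + 1)%:~R[%classic.
  apply/seteqP; split=> t /=; first by move=> <-; rewrite in_itv/= floor_itv.
  by rewrite in_itv/= => /floor_def.
rewrite -[X in measurable X]setTI.
by apply: (measurable_funM (measurable_cst _) mg) => //; exact: measurable_itv.
Qed.

(** With g_n within 1/(n+1) of g, and s_n approximating f, the error splits as
    g f - g_n s_n = (g - g_n) f + g_n (f - s_n),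
    whose integral is at most (int |f|) / (n+1) + 2 int |f - s_n|. *)
Lemma bochner_integrableZ {g : T -> R} {f} : measurable_fun [set: T] g ->
  (forall t, `|g t| <= 1) -> bochner_integrable mu f ->
  bochner_integrable mu (fun t => g t *: f t).
Proof.
move=> mg g1 [s_ fs].
pose g_ n := grid_floor n g.
have gfin n : finitely_valued (g_ n) by exact: finitely_valued_grid_floor.
have sfin n : finitely_valued (s_ n) by case: fs => sn _ _; apply/bochner_simpleP.
have dist n t : `|g t - g_ n t| <= n.+1%:R^-1 by exact: grid_floor_dist.
have gsfin n : finitely_valued (fun t => g_ n t *: s_ n t).
  exact: (finitely_valued_comp (fun p : R * H => p.1 *: p.2)
    (finitely_valued_pair (gfin n) (sfin n))).
have g_cvg t : g_ n t @[n --> \oo] --> g t.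
  apply/subr_cvg0/norm_cvg0P.
  apply: (@squeeze_cvgr _ _ _ _ (cst 0) harmonic).
  - by apply: nearW => n; rewrite /= normr_ge0 distrC dist.
  - exact: cvg_cst.
  - exact: cvg_harmonic.
have gscvg t : g_ n t *: s_ n t @[n --> \oo] --> g t *: f t.
  by apply: cvgZ => //; case: fs => _ /(_ t).
have inorm := integrable_norm_bochner fs.
exists (fun n t => g_ n t *: s_ n t); split => //.
  by move=> n; apply/bochner_simpleP.
have mf : measurable_fun [set: T] (fun t => (`|f t|%:E : \bar R)).
  by apply/measurable_EFinP; exact: (measurable_continuous_bochner fs (@norm_continuous _ _)).
have merr n : measurable_fun [set: T] (fun t => (`|f t - s_ n t|%:E : \bar R)).
  by apply/measurable_EFinP; exact: measurable_bochner_error.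
have bound n : (\int[mu]_t `|g t *: f t - g_ n t *: s_ n t|%:E <=
    (harmonic n)%:E * \int[mu]_t `|f t|%:E + 2%:E * \int[mu]_t `|f t - s_ n t|%:E)%E.
  rewrite -!ge0_integralZl//= -ge0_integralD//=; first last.
  - exact: measurable_funeM.
  - exact: measurable_funeM.
  apply: ge0_le_integral => //=.
  - apply/measurable_EFinP.
    exact: (measurable_norm_sub gsfin gscvg (gsfin n)).
  - by apply: emeasurable_funD; exact: measurable_funeM.
  - move=> t _; rewrite lee_fin.
    have -> : g t *: f t - g_ n t *: s_ n t =
        (g t - g_ n t) *: f t + g_ n t *: (f t - s_ n t).
      by rewrite scalerBl scalerBr addrA subrK.
    have gn2 : `|g_ n t| <= 2.
      rewrite -(subrK (g t) (g_ n t)) (le_trans (ler_normD _ _))//.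
      rewrite (_ : 2 = 1 + 1)// lerD// distrC (le_trans (dist n t))//.
      by rewrite invf_le1// ler1n.
    by rewrite (le_trans (ler_normD _ _))// lerD// normrZ ler_wpM2r.
apply: squeeze_cvge.
- by apply: nearW => n; apply/andP; split; [apply: integral_ge0|exact: bound].
- exact: cvg_cst.
have Ifin : (\int[mu]_t `|f t|%:E)%E \is a fin_num by exact: integrable_fin_num inorm.
rewrite -[X in _ --> X]adde0; apply: cvgeD => //.
  rewrite -[X in _ --> X](mul0e (\int[mu]_t `|f t|%:E)%E).
  by apply: cvgeM; [exact: mule_def_fin|exact: cvge_harmonic|exact: cvg_cst].
rewrite -[X in _ --> X](mule0 2%:E).
by apply: cvgeM; [exact: mule_def_fin|exact: cvg_cst|case: fs].
Qed.

End bochner.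

(** * Coordinates and Moebius maps on the circle *)

Section circle_coordinates.
Context {R : realType}.
Implicit Type z : circle R.

Let re z : R := complex.Re (val z).
Let im z : R := complex.Im (val z).

Lemma circle_sqrDsqr z : re z ^+ 2 + im z ^+ 2 = 1.
Proof.
case: z => w w1; have := add_Re2_Im2 w; rewrite (eqP w1) expr1n.
by move=> /(congr1 (@complex.Re R)).
Qed.

Lemma circle_Re_le1 z : `|re z| <= 1.
Proof.
rewrite -(@ler_sqr _ `|_|) ?nnegrE// real_normK ?num_real// expr1n.
by rewrite -(circle_sqrDsqr z) lerDl sqr_ge0.
Qed.

Lemma circle_Im_le1 z : `|im z| <= 1.
Proof.
rewrite -(@ler_sqr _ `|_|) ?nnegrE// real_normK ?num_real// expr1n.
by rewrite -(circle_sqrDsqr z) lerDr sqr_ge0.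
Qed.

Lemma measurable_circle_coords :
  measurable_fun [set: circle R] (circle_coords : circle R -> _).
Proof. by move=> _ B mB; rewrite setTI; exists B => //; rewrite setTI. Qed.

Lemma measurable_circle_Re : measurable_fun [set: circle R] re.
Proof. by have /measurable_fun_pairP[] := measurable_circle_coords. Qed.

Lemma measurable_circle_Im : measurable_fun [set: circle R] im.
Proof. by have /measurable_fun_pairP[] := measurable_circle_coords. Qed.

Lemma circle_invE z : (val z)^-1 = re z -i* im z.
Proof.
rewrite /re /im; case: z => w w1; rewrite invc_norm (eqP w1) expr1n invr1 mul1r.
by case: w w1.
Qed.

Lemma moebius_weightE s z : moebius_weight s (val z) = 1 + s ^+ 2 + 2 * s * re z.
Proof.
have := circle_sqrDsqr z; rewrite /re /im /moebius_weight.
case: (val z) => x y /= xy.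
simpc; rewrite /= sqr_sqrtr ?addr_ge0 ?sqr_ge0//.
have -> : 1 + s ^+ 2 + 2 * s * x = 1 + s ^+ 2 * (x ^+ 2 + y ^+ 2) + 2 * s * x.
  by rewrite xy mulr1.
ring.
Qed.

(** Real and imaginary parts of (s + z)(1 + s conj z), the norm of z being 1; the
    weight is at least (1 - s)^2, hence nonzero. *)
Lemma moebius_weight_moebius s z : 0 <= s -> s < 1 ->
  moebius_weight s (val z) * complex.Re (moebius s (val z)) =
    (1 + s ^+ 2) * re z + 2 * s /\
  moebius_weight s (val z) * complex.Im (moebius s (val z)) =
    (1 - s ^+ 2) * im z.
Proof.
move=> s0 s1.
have w0 : moebius_weight s (val z) != 0.
  have := circle_Re_le1 z; rewrite moebius_weightE ler_norml => /andP[x1 _].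
  rewrite gt_eqF//; nra.
have := circle_sqrDsqr z; move: w0; rewrite /re /im /moebius_weight /moebius.
case: (val z) => x y; simpc => /=; rewrite sqr_sqrtr ?addr_ge0 ?sqr_ge0// => w0 xy.
set q := _ ^+ 2 + _ in w0 *; split.
- have -> : (1 + s ^+ 2) * x + 2 * s =
      (1 + s ^+ 2) * x + s * (1 + (x ^+ 2 + y ^+ 2)) by rewrite xy; ring.
  by field.
- by field.
Qed.

Context {H : hilbertType R}.

Lemma weighted_moebius_curveE (e1 e2 p v : H) (c s : R) z : 0 <= s -> s < 1 ->
  moebius_weight s (val z) * inner v (moebius_curve e1 e2 p c s (val z)) =
    (1 + s ^+ 2) * inner v p + 2 * s * (re z * inner v p)
    + c * ((1 + s ^+ 2) * (re z * inner v e1) + 2 * s * inner v e1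
           + (1 - s ^+ 2) * (im z * inner v e2)).
Proof.
move=> s0 s1; have [wre wim] := moebius_weight_moebius s z s0 s1.
rewrite /moebius_curve !innerDr !innerZr !mulrDr.
rewrite [X in _ + X + _](_ : _ = c * (((1 + s ^+ 2) * re z + 2 * s) * inner v e1)); last first.
  by rewrite -wre; ring.
rewrite [X in _ + _ + X](_ : _ = c * ((1 - s ^+ 2) * im z * inner v e2)); last first.
  by rewrite -wim; ring.
rewrite moebius_weightE; ring.
Qed.

End circle_coordinates.

(** * Integrals of real functions *)

Section real_integrals.
Context {d : measure_display} {T : measurableType d} {R : realType}.
Variable mu : {measure set T -> \bar R}.
Implicit Types g h : T -> R.

Lemma integrable_unit_mul {g h} : measurable_fun [set: T] h ->
  (forall t, `|h t| <= 1) -> mu.-integrable [set: T] (EFin \o g) ->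
  mu.-integrable [set: T] (EFin \o (fun t => h t * g t)).
Proof.
move=> mh h1 ig; apply: (le_integrable _ _ _ ig) => //.
  apply/measurable_EFinP; apply: measurable_funM => //.
  by apply/measurable_EFinP; exact: measurable_int ig.
by move=> t _ /=; rewrite lee_fin normrM ler_piMl.
Qed.

Lemma ae_eq_Rintegral {g h} : measurable_fun [set: T] g -> measurable_fun [set: T] h ->
  {ae mu, forall t, g t = h t} -> \int[mu]_t g t = \int[mu]_t h t.
Proof.
move=> mg mh gh; congr fine; apply: ae_eq_integral => //.
- exact/measurable_EFinP.
- exact/measurable_EFinP.
- by apply: filterS gh => t ->.
Qed.

End real_integrals.

(** * Fourier coefficients and the pairing *)

Section fourier.
Context {R : realType}.
Variables g h : circle R -> R.
Hypothesis ig : arc_measure.-integrable [set: circle R] (EFin \o g).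
Hypothesis ih : arc_measure.-integrable [set: circle R] (EFin \o h).
Let phi (z : circle R) : R[i] := g z +i* h z.
Let xg := \int[arc_measure]_z (complex.Re (val z) * g z).
Let yh := \int[arc_measure]_z (complex.Im (val z) * h z).

Let ixg := integrable_unit_mul arc_measure measurable_circle_Re circle_Re_le1 ig.
Let iyh := integrable_unit_mul arc_measure measurable_circle_Im circle_Im_le1 ih.

Lemma Re_fourier_coef0 :
  complex.Re (fourier_coef phi 0) = \int[arc_measure]_z g z.
Proof. by apply: eq_Rintegral => z _; rewrite oppr0 expr0z mulr1. Qed.

Lemma Re_fourier_coef1 : complex.Re (fourier_coef phi 1) = xg + yh.
Proof.
rewrite -RintegralD//; apply: eq_Rintegral => z _.
rewrite exprN1 circle_invE /phi; simpc => /=; ring.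
Qed.

Lemma Re_fourier_coefN1 : complex.Re (fourier_coef phi (-1)) = xg - yh.
Proof.
rewrite -RintegralB//; apply: eq_Rintegral => z _.
rewrite opprK expr1z /phi; case: (val z) => x y; simpc => /=; ring.
Qed.

End fourier.

Section pairing.
Context {R : realType} {H : hilbertType R}.
Local Notation mu := (@arc_measure R).

(** The pairing depends on Phi only through five scalar moments, for which the
    decomposition of Phi along the plane and its orthogonal complement can be
    used one component at a time. *)
Lemma moebius_pairingE (e1 e2 p : H) (c s : R) (Phi : circle R -> H) :
  0 <= s -> s < 1 -> bochner_integrable mu Phi ->
  moebius_pairing e1 e2 p c s Phi =
    (1 + s ^+ 2) * \int[mu]_z inner (Phi z) p
    + 2 * s * \int[mu]_z (complex.Re (val z) * inner (Phi z) p)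
    + c * ((1 + s ^+ 2) * \int[mu]_z (complex.Re (val z) * inner (Phi z) e1)
           + 2 * s * \int[mu]_z inner (Phi z) e1
           + (1 - s ^+ 2) * \int[mu]_z (complex.Im (val z) * inner (Phi z) e2)).
Proof.
move=> s0 s1 [s_ Phis].
have iP := integrable_inner_bochner _ Phis.
have ixP w := integrable_unit_mul mu measurable_circle_Re circle_Re_le1 (iP w).
have iyP w := integrable_unit_mul mu measurable_circle_Im circle_Im_le1 (iP w).
rewrite /moebius_pairing.
under eq_Rintegral do rewrite weighted_moebius_curveE//.
have Z k (g : circle R -> R) (ig : mu.-integrable [set: circle R] (EFin \o g)) :
    mu.-integrable [set: circle R] (EFin \o (fun z => k * g z)).
  exact: (integrableZl measurableT k ig).
have D (g h : circle R -> R) (ig : mu.-integrable [set: circle R] (EFin \o g))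
    (ih : mu.-integrable [set: circle R] (EFin \o h)) :
    mu.-integrable [set: circle R] (EFin \o (fun z => g z + h z)).
  exact: (integrableD measurableT ig ih).
have Dint g h ig ih := @RintegralD _ _ _ mu _ g h measurableT ig ih.
have Zint g k ig := @RintegralZl _ _ _ mu _ g k measurableT ig.
have i1 := Z (1 + s ^+ 2) _ (iP p).
have i2 := Z (2 * s) _ (ixP p).
have i3 := Z (1 + s ^+ 2) _ (ixP e1).
have i4 := Z (2 * s) _ (iP e1).
have i5 := Z (1 - s ^+ 2) _ (iyP e2).
have i34 := D _ _ i3 i4; have i345 := D _ _ i34 i5.
rewrite (Dint _ _ (D _ _ i1 i2) (Z c _ i345)) (Dint _ _ i1 i2) (Zint _ _ i345).
rewrite (Dint _ _ i34 i5) (Dint _ _ i3 i4).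
by rewrite (Zint _ _ (iP p)) (Zint _ _ (ixP p)) (Zint _ _ (ixP e1))
  (Zint _ _ (iP e1)) (Zint _ _ (iyP e2)).
Qed.

End pairing.

Theorem theorem3p1 (R : realType) (H : hilbertType R)
    (Lambda : oriented_plane H) (e1 e2 : H)
    (he : oriented_orthonormal_basis Lambda e1 e2)
    (p : H) (hp : ortho_compl Lambda p) (b : R) (hb : b = `|p|)
    (c : R) (hc : 0 < c) (s : R) (hs0 : 0 <= s) (hs1 : s < 1)
    (Phi xi eta : circle R -> H)
    (hPhi : L1 arc_measure [set: H] Phi)
    (hxi : L1 arc_measure Lambda xi)
    (heta : L1 arc_measure (ortho_compl Lambda) eta)
    (hdec : {ae arc_measure, forall z, Phi z = xi z + eta z})
    (phi : circle R -> R[i])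
    (hphi : forall z, phi z = complex_coord e1 e2 (xi z))
    (a : R) (A B : R[i])
    (hphi0 : fourier_coef phi 0 = a%:C)
    (hphi1 : fourier_coef phi 1 = A)
    (hphiN1 : fourier_coef phi (-1) = B)
    (heta0 : bochner_integral arc_measure eta = p)
    (heta1 : bochner_integral arc_measure
               (fun z => complex.Re (val z) *: eta z) = 0) :
  moebius_pairing e1 e2 p c s Phi =
    c * complex.Re (A + 2 * s%:C * a%:C + s%:C ^+ 2 * B) + (1 + s ^+ 2) * b ^+ 2.
Proof.
set mu := @arc_measure R.
have [iPhi _] := hPhi; have [ixi xiL] := hxi; have [ieta etaL] := heta.
(* e1, e2 is itself a positive basis, hence made of combinations of the basis
   that defines the plane *)
have [Le1 Le2] : plane_set Lambda e1 /\ plane_set Lambda e2.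
  have [u [v [_ -> pos]]] := oriented_planeP Lambda.
  have [/pos[k [l [m [n [-> -> _]]]]] _ _ _] := he.
  by split; [exists k, l|exists m, n].
have [sP PhisP] := iPhi; have [sx xisx] := ixi; have [se etase] := ieta.
have iP := integrable_inner_bochner mu PhisP.
have ix := integrable_inner_bochner mu xisx.
have ie := integrable_inner_bochner mu etase.
pose re (z : circle R) : R := complex.Re (val z).
pose im (z : circle R) : R := complex.Im (val z).
have ae_p : {ae mu, forall z, inner (Phi z) p = inner (eta z) p}.
  apply: filterS2 hdec xiL => z -> Lz.
  by rewrite innerDl (innerC (xi z)) hp// add0r.
have ae_e e : plane_set Lambda e -> {ae mu, forall z, inner (Phi z) e = inner (xi z) e}.
  move=> Le; apply: filterS2 hdec etaL => z -> Lz.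
  by rewrite innerDl Lz// addr0.
have mP w : measurable_fun [set: circle R] (fun z => inner (Phi z) w).
  by apply/measurable_EFinP; exact: measurable_int (iP w).
have mx w : measurable_fun [set: circle R] (fun z => inner (xi z) w).
  by apply/measurable_EFinP; exact: measurable_int (ix w).
have me w : measurable_fun [set: circle R] (fun z => inner (eta z) w).
  by apply/measurable_EFinP; exact: measurable_int (ie w).
have mre : measurable_fun [set: circle R] re := measurable_circle_Re.
have mim : measurable_fun [set: circle R] im := measurable_circle_Im.
rewrite moebius_pairingE//.
have -> : \int[mu]_z inner (Phi z) p = b ^+ 2.
  rewrite (ae_eq_Rintegral mu (mP p) (me p) ae_p) -inner_bochner_integral//.
  by rewrite heta0 inner_normE hb.
have -> : \int[mu]_z (re z * inner (Phi z) p) = 0.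
  rewrite (@ae_eq_Rintegral _ _ _ mu _ (fun z => re z * inner (eta z) p)).
  - (* integrability makes the hypothesis on the first cosine moment a statement
       about an actual integral rather than about the junk value *)
    have ireta := bochner_integrableZ mu measurable_circle_Re circle_Re_le1 ieta.
    rewrite -(inner0l p) -heta1 inner_bochner_integral//.
    by apply: eq_Rintegral => z _; rewrite innerZl.
  - exact: measurable_funM.
  - exact: measurable_funM.
  - by apply: filterS ae_p => z ->.
have -> : \int[mu]_z (re z * inner (Phi z) e1) = \int[mu]_z (re z * inner (xi z) e1).
  apply: ae_eq_Rintegral; [exact: measurable_funM|exact: measurable_funM|].
  by apply: filterS (ae_e _ Le1) => z ->.
have -> : \int[mu]_z (im z * inner (Phi z) e2) = \int[mu]_z (im z * inner (xi z) e2).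
  apply: ae_eq_Rintegral; [exact: measurable_funM|exact: measurable_funM|].
  by apply: filterS (ae_e _ Le2) => z ->.
rewrite (ae_eq_Rintegral mu (mP e1) (mx e1) (ae_e _ Le1)).
have phiE : phi = fun z => inner (xi z) e1 +i* inner (xi z) e2 by apply/funext.
have := Re_fourier_coef0 (fun z => inner (xi z) e1) (fun z => inner (xi z) e2).
rewrite -phiE hphi0 /= => <-.
have := Re_fourier_coef1 _ _ (ix e1) (ix e2); rewrite -phiE hphi1.
have := Re_fourier_coefN1 _ _ (ix e1) (ix e2); rewrite -phiE hphiN1.
set xg := \int[_]_z _; set yh := \int[_]_z _ => reB reA.
rewrite -/(re _) -/(im _) -/xg -/yh.
have -> : complex.Re (A + 2 * s%:C * a%:C + s%:C ^+ 2 * B) =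
    complex.Re A + 2 * s * a + s ^+ 2 * complex.Re B.
  case: (A) (B) => [x y] [x' y']; rewrite !expr2; simpc => /=; ring.
rewrite reA reB; ring.
Qed.
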